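(* Let $D$ be an invertible digraph on $\{1,\dots,n-1\}$ and let $S\subseteq\{1,\dots,n-1\}$ be a valid subset. For a vertex $d\in D$ define $S_d=\{s\in S : d\leadsto s\}$, and partition $S_d$ into two sets $S_d^+$ and $S_d^-$ according to whether $\langle s,n\rangle=+1$ or $\langle s,n\rangle=-1$ in $D_S$. Then $D_S$ is invertible if and only if for all $d\in D$ with $|S_d|\ge 2$ we have $$\sum_{s\in S_d^-}|B_{d,s}^{-1}|\ \ge\ \sum_{s\in S_d^+}|B_{d,s}^{-1}|.$$
   Context: Digraphs are finite, have vertex set $\{1,\dots,m\}$ for some $m$, may have multiple edges but no loops, and every directed edge $i\to j$ satisfies $i<j$. For a digraph $D$ on $\{1,\dots,m\}$, let $B=B_D$ be the $m\times m$ upper unitriangular integer matrix with $B_{i,i}=1$ and $B_{i,j}$ equal to the number of edges from $i$ to $j$ for $i\ne j$; $B^{-1}_{i,j}$ denotes the $(i,j)$ entry of $B^{-1}$ (in the claim, $B=B_D$; for $d,s\le n-1$ the entry is the same for $D$ and $D_S$). $D$ is invertible if there is a diagonal matrix $T$ with diagonal entries in $\{\pm1\}$ such that $TB^{-1}T=|B^{-1}|$, where $|\cdot|$ is the componentwise absolute value. Write $d\leadsto d'$ if there is a directed path from $d$ to $d'$; paths of length $0$ are allowed, so $d\leadsto d$. For vertices $i,j$ of a digraph set $\langle i,j\rangle=(-1)^{\ell}$, where $\ell$ is the maximal length of a directed path from $i$ to $j$ in that digraph, and $\langle i,j\rangle=0$ if there is no such path. The maximal-path subgraph $\Gamma_D$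 of a digraph $D$ is the spanning subgraph containing an edge $e$ of $D$ if and only if there are vertices $i,j$ such that $e$ lies on a directed path from $i$ to $j$ whose length is maximal among all directed paths from $i$ to $j$ in $D$. A digraph is bipartite if its underlying undirected graph is. Given an invertible digraph $D$ on $\{1,\dots,n-1\}$ and a subset $S$ of its vertices, $D_S$ denotes the digraph on $\{1,\dots,n\}$ obtained by adjoining to $D$ a new vertex $n$ and adding one edge $s\to n$ for each $s\in S$. $S$ is valid if $\Gamma_{D_S}$ is bipartite. *)

(* Defs.v *)
From mathcomp Require Import all_boot all_order all_algebra.
Set Implicit Arguments.
Unset Strict Implicit.
Unset Printing Implicit Defensive.
Import Order.TTheory GRing.Theory Num.Theory.
Local Open Scope ring_scope.

(* [mult i j] is the number of edges from i to j. Parallel edges are not       *)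
(* distinguished: every notion below depends on an edge only through its       *)
(* endpoints. The vertices 1, ..., m are represented by 'I_m, i.e. shifted     *)
(* down by one; [mult_lt] also excludes loops.                                 *)
Record digraph (m : nat) := Digraph {
  mult : 'I_m -> 'I_m -> nat;
  mult_lt : forall i j : 'I_m, (0 < mult i j)%N -> (i < j)%N
}.

Definition edge m (D : digraph m) : rel 'I_m := fun i j => (0 < mult D i j)%N.

Definition Bmx m (D : digraph m) : 'M[int]_m :=
  \matrix_(i, j) (if i == j then 1 else (mult D i j)%:Z).

Definition Binv m (D : digraph m) : 'M[int]_m := invmx (Bmx D).

Definition invertible m (D : digraph m) : Prop :=
  exists t : 'rV[int]_m, (forall i, t 0 i = 1 \/ t 0 i = -1) /\
    diag_mx t *m Binv D *m diag_mx t = map_mx Num.norm (Binv D).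

Definition leadsto m (D : digraph m) : rel 'I_m := connect (edge D).

(* The vertices of the path are i :: p, so its length is [size p]. *)
Definition dpath m (D : digraph m) (i j : 'I_m) (p : seq 'I_m) : bool :=
  path (edge D) i p && (last i p == j).

(* The bound l < m loses nothing, see [leq_longest]; if there is no path from  *)
(* i to j the value is 0.                                                      *)
Definition longest m (D : digraph m) (i j : 'I_m) : nat :=
  \max_(l < m | [exists p : l.-tuple 'I_m, dpath D i j p]) l.

Definition psign m (D : digraph m) (i j : 'I_m) : int :=
  if leadsto D i j then (-1) ^+ longest D i j else 0.

(* [zip (i :: p) p] lists the pairs of consecutive vertices of the path. *)
Definition on_longest m (D : digraph m) (u v : 'I_m) : bool :=
  [exists i : 'I_m, exists j : 'I_m, exists p : (longest D i j).-tuple 'I_m,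
     dpath D i j p && ((u, v) \in zip (i :: p) p)].

Definition Gamma_mult m (D : digraph m) (u v : 'I_m) : nat :=
  if on_longest D u v then mult D u v else 0%N.

Lemma Gamma_mult_lt m (D : digraph m) (u v : 'I_m) :
  (0 < Gamma_mult D u v)%N -> (u < v)%N.
Proof. by rewrite /Gamma_mult; case: ifP => // _; apply: mult_lt. Qed.

Definition Gamma m (D : digraph m) : digraph m := Digraph (@Gamma_mult_lt m D).

Definition bipartite m (D : digraph m) : Prop :=
  exists c : 'I_m -> bool, forall i j, edge D i j -> c i != c j.

(* The new vertex is [ord_max], and d in D becomes [lift ord_max d], which has *)
(* the same value as d.                                                        *)
Definition adjoin_mult k (D : digraph k) (S : {set 'I_k}) (i j : 'I_k.+1) : nat :=
  match unlift ord_max i, unlift ord_max j with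
  | Some a, Some b => mult D a b
  | Some a, None => (a \in S)
  | None, _ => 0%N
  end.

Lemma adjoin_mult_lt k (D : digraph k) (S : {set 'I_k}) (i j : 'I_k.+1) :
  (0 < adjoin_mult D S i j)%N -> (i < j)%N.
Proof.
have vE (a : 'I_k) : nat_of_ord (lift ord_max a) = a by exact: lift_max.
rewrite /adjoin_mult; case: unliftP => [a|] -> //.
case: unliftP => [b|] ->; rewrite !vE; first exact: mult_lt.
by move=> _; exact: ltn_ord.
Qed.

Definition adjoin k (D : digraph k) (S : {set 'I_k}) : digraph k.+1 :=
  Digraph (@adjoin_mult_lt k D S).

Definition valid k (D : digraph k) (S : {set 'I_k}) : Prop :=
  bipartite (Gamma (adjoin D S)).

Definition Sd k (D : digraph k) (S : {set 'I_k}) (d : 'I_k) : {set 'I_k} :=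
  [set s in S | leadsto D d s].

Definition Sd_plus k (D : digraph k) (S : {set 'I_k}) (d : 'I_k) : {set 'I_k} :=
  [set s in Sd D S d | psign (adjoin D S) (lift ord_max s) ord_max == 1].

Definition Sd_minus k (D : digraph k) (S : {set 'I_k}) (d : 'I_k) : {set 'I_k} :=
  [set s in Sd D S d | psign (adjoin D S) (lift ord_max s) ord_max == -1].

Lemma dpath_size m (D : digraph m) (i j : 'I_m) (p : seq 'I_m) :
  dpath D i j p -> (size p < m)%N.
Proof.
case/andP=> pP _; have uP : uniq (i :: p).
  have ltT : transitive (relpre (@nat_of_ord m) ltn).
    by move=> y x z; exact: ltn_trans.
  apply: (sorted_uniq ltT) => [x /=|]; first exact: ltnn.
  by apply: sub_path pP => x y; apply: mult_lt.
by have := max_card (mem (i :: p)); rewrite (card_uniqP uP) card_ord.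
Qed.

Lemma leq_longest m (D : digraph m) (i j : 'I_m) (p : seq 'I_m) :
  dpath D i j p -> (size p <= longest D i j)%N.
Proof.
move=> Hp; have lt_p := dpath_size Hp.
apply: (leq_bigmax_cond (Ordinal lt_p) (F := fun l : 'I_m => nat_of_ord l)).
by apply/existsP; exists (in_tuple p).
Qed.

Lemma longest_dpath m (D : digraph m) (i j : 'I_m) :
  leadsto D i j -> exists2 p, dpath D i j p & size p = longest D i j.
Proof.
case/connectP=> q qP ej.
have Hq : dpath D i j q by rewrite /dpath qP ej eqxx.
pose l0 := Ordinal (dpath_size Hq).
have P0 : [exists p : l0.-tuple 'I_m, dpath D i j p].
  by apply/existsP; exists (in_tuple q).
rewrite /longest (bigop.bigmax_eq_arg l0) //.
case: arg_maxnP => // l /existsP[p Hp] _; exists p => //; exact: size_tuple.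
Qed.

Lemma Bmx_unit m (D : digraph m) : Bmx D \in unitmx.
Proof.
have tP : is_trig_mx (Bmx D)^T.
  apply/is_trig_mxP => i j lt_ij; rewrite !mxE.
  case: (eqVneq j i) => [e|_]; first by move: lt_ij; rewrite e ltnn.
  case: (posnP (mult D j i)) => [->|/mult_lt lt_ji]; first by [].
  by move: (ltn_trans lt_ij lt_ji); rewrite ltnn.
rewrite -unitmx_tr unitmxE (det_trig tP) big1 ?unitr1 // => i _.
by rewrite !mxE eqxx.
Qed.

(* Main.v *)
Require Import Defs.
From mathcomp Require Import all_boot all_order all_algebra.
Set Implicit Arguments.
Unset Strict Implicit.
Unset Printing Implicit Defensive.
Import Order.TTheory GRing.Theory Num.Theory.
Local Open Scope ring_scope.

(** The entry [Binv D i j] is the signed count of the paths from [i] to [j],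
    so it vanishes unless [i] leads to [j], and it equals [- mult D i j] when
    the single edges are the only paths from [i] to [j].  The latter happens
    exactly on the edges of the maximal-path subgraph, because a detour around
    an edge of a longest path would lengthen that path.  Hence a sign vector
    [t] that makes [Binv D] nonnegative by conjugation must change sign along
    every edge of [Gamma D].  Any two vertices with [i] leading to [j] are
    joined by a longest path, all of whose edges are in [Gamma D], so
    [t i * t j] can only be [psign D i j].  Invertibility is thus a statement
    about the intrinsic signs: when [Gamma D] is bipartite, it says that
    [psign D i j * Binv D i j] is nonnegative for all [i] and [j]
    ([invertible_psign_ge0], [psign_ge0_invertible]).  Bipartiteness also makes
    [psign] multiplicative along paths ([psignM]).

    Adjoining a sink [n] above [S] leaves the signs and the inverse matrix of
    [D] unchanged and adds the column [- \sum_(s in S) Binv D d s].  Since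
    [psign] is multiplicative, the product of the entry at [(d, n)] with
    [psign d n] is [- \sum_(s in Sd D S d) psign s n * `|Binv D d s|], which is
    the difference of the two sums in the criterion
    ([psign_Binv_adjoin_max]).  If [Sd D S d] is empty this difference is zero;
    if it is a singleton [s], then nothing but the edge leads from [s] to [n],
    so [psign s n] is [-1] and the inequality is automatic. *)

(** * The support of the inverse matrix *)

Section Inverse.
Variables (m : nat) (D : digraph m).
Implicit Types i j u v : 'I_m.

Lemma edge_lt i j : edge D i j -> (i < j)%N.
Proof. exact: mult_lt. Qed.

Lemma path_edge_leq i p : path (edge D) i p -> (i + size p <= last i p)%N.
Proof.
elim: p i => [|x p IHp] i /=; first by rewrite addn0.
case/andP=> /edge_lt lt_ix /IHp; apply: leq_trans.
by rewrite addnS -addSn leq_add2r.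
Qed.

Lemma leadsto_leq i j : leadsto D i j -> (i <= j)%N.
Proof.
case/connectP=> p /path_edge_leq le_p ->.
exact: leq_trans (leq_addr _ _) le_p.
Qed.

Lemma dpath_leadsto i j p : dpath D i j p -> leadsto D i j.
Proof. by case/andP=> pP /eqP ej; apply/connectP; exists p. Qed.

(** Row [i] of the identity [Bmx D *m Binv D = 1%:M], solved for [Binv D i j]:
    a nontrivial path from [i] starts with an edge. *)
Lemma Binv_rec i j :
  Binv D i j = (i == j)%:R - \sum_(k | k != i) (mult D i k)%:Z * Binv D k j.
Proof.
have /matrixP/(_ i j) := mulmxV (Bmx_unit D).
rewrite !mxE (bigD1 i) //= mxE eqxx mul1r => <-; rewrite /Binv.
under eq_bigr => k /negPf nki do rewrite mxE eq_sym nki.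
by rewrite addrK.
Qed.

Lemma Binv_eq0 i j : ~~ leadsto D i j -> Binv D i j = 0.
Proof.
(* Edges increase the vertex, so the induction descends from the last one. *)
have [n] := ubnP (m - i)%N; elim: n i => // n IHn i lt_mi nij.
rewrite Binv_rec big1 => [|k _].
  by case: eqVneq nij => [->|]; rewrite ?subr0 // /leadsto connect0.
case: (posnP (mult D i k)) => [->|ik]; first by rewrite mul0r.
rewrite IHn ?mulr0 //.
  by apply: leq_trans (lt_mi : (m - i <= n)%N); rewrite ltn_sub2l ?(mult_lt ik).
by apply: contra nij; apply: connect_trans; apply: connect1.
Qed.

Lemma Binv_diag i : Binv D i i = 1.
Proof.
rewrite Binv_rec eqxx big1 ?subr0 // => k _.
case: (posnP (mult D i k)) => [->|ik]; first by rewrite mul0r.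
rewrite Binv_eq0 ?mulr0 //; apply/negP => /leadsto_leq.
by rewrite leqNgt (mult_lt ik).
Qed.

(** * Signs along longest paths *)

Lemma psign_refl i : psign D i i = 1.
Proof.
have ii : leadsto D i i by exact: connect0.
rewrite /psign ii; have [p /andP[/path_edge_leq le_p /eqP ep] <-] := longest_dpath ii.
by move: le_p; rewrite ep -[leqRHS]addn0 leq_add2l leqn0 => /eqP->.
Qed.

Lemma path_zipE (T : eqType) (e : rel T) x p :
  path e x p = all (fun xy => e xy.1 xy.2) (zip (x :: p) p).
Proof. by elim: p x => //= y p IHp x; rewrite IHp. Qed.

Lemma mem_zip_cons_split (T : eqType) (x u v : T) p :
  (u, v) \in zip (x :: p) p ->
  exists p1 p2, p = p1 ++ v :: p2 /\ last x p1 = u.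
Proof.
elim: p x => //= y p IHp x; rewrite inE => /predU1P[[-> ->]|/IHp].
  by exists [::], p.
by move=> [p1 [p2 [-> <-]]]; exists (y :: p1), p2.
Qed.

(** Any other way to leave [u] towards [v] could be spliced into the longest
    path through the edge [u -> v], making it longer. *)
Lemma on_longest_no_detour u v k :
  on_longest D u v -> edge D u k -> leadsto D k v -> k = v.
Proof.
case/existsP=> i /existsP[j /existsP[p /andP[]]].
case/andP=> pP /eqP ej /mem_zip_cons_split[p1 [p2 [ep eu]]] uk /connectP[q qP ev].
case: q => [|x q] in qP ev *; first by [].
have/leq_longest: dpath D i j (p1 ++ k :: (x :: q) ++ p2).
  move: pP ej; rewrite ep /dpath !cat_path !last_cat eu /=.
  case/and3P=> -> _ p2P ej; rewrite uk cat_path last_cat.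
  move: qP ev => /= /andP[-> ->] <-.
  by rewrite p2P ej eqxx.
rewrite -[leqRHS](size_tuple p) ep !size_cat /= leq_add2l size_cat !ltnS.
by rewrite leqNgt ltnS leq_addl.
Qed.

Lemma Binv_on_longest u v :
  on_longest D u v -> edge D u v -> Binv D u v = - (mult D u v)%:Z.
Proof.
move=> uv_long uv; have lt_uv := edge_lt uv.
have nuv : v != u by rewrite -val_eqE /= gtn_eqF.
rewrite Binv_rec eq_sym (negPf nuv) sub0r; congr (- _).
rewrite (bigD1 v) //= Binv_diag mulr1 big1 ?addr0 // => k /andP[_ nkv].
case: (posnP (mult D u k)) => [->|uk]; first by rewrite mul0r.
rewrite Binv_eq0 ?mulr0 //; apply: contra nkv => kv.
by apply/eqP; apply: on_longest_no_detour uv_long uk kv.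
Qed.

Lemma edge_Gamma u v : edge (Gamma D) u v = on_longest D u v && edge D u v.
Proof. by rewrite /edge /= /Gamma_mult; case: ifP. Qed.

(** The signs of a 2-colouring of [Gamma D] and the diagonal of a matrix that
    witnesses invertibility both have this property, so one comparison with
    [psign] serves both. *)
Definition Gamma_signing (t : 'I_m -> int) : Prop :=
  (forall i, t i = 1 \/ t i = -1) /\
  (forall u v, edge (Gamma D) u v -> t u * t v = -1).

Lemma signing_mulK (t : 'I_m -> int) i : Gamma_signing t -> t i * t i = 1.
Proof. by case=> tP _; case: (tP i) => ->. Qed.

Lemma signing_mulMK t i x y : Gamma_signing t -> x * t i * (t i * y) = x * y.
Proof. by move=> tG; rewrite mulrA -(mulrA x) (signing_mulK i tG) mulr1. Qed.

(** The edges of a longest path from [i] to [j] all belong to [Gamma D], so [t]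
    changes sign [longest D i j] times along it. *)
Lemma signing_psign t i j :
  Gamma_signing t -> leadsto D i j -> psign D i j = t i * t j.
Proof.
move=> tG ij; rewrite /psign ij; have [p pij sp] := longest_dpath ij.
have: path (fun u v => t u * t v == -1) i p.
  rewrite path_zipE; apply/allP => -[u v] uv /=; apply/eqP/tG.2.
  have pP : path (edge D) i p by case/andP: pij.
  rewrite edge_Gamma (allP (_ : all (fun e => edge D e.1 e.2) _) _ uv) -?path_zipE //.
  rewrite andbT; apply/existsP; exists i; apply/existsP; exists j.
  apply/existsP; have/eqP sp' := sp.
  by exists (Tuple sp'); rewrite pij uv.
rewrite -sp; case/andP: pij => _ /eqP <-.
elim: p i {ij sp} => [|x p IHp] i /=; first by rewrite (signing_mulK _ tG).
case/andP=> /eqP tix /IHp; rewrite exprS -tix => ->.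
by rewrite (signing_mulMK _ _ _ tG).
Qed.

Lemma bipartite_signing : bipartite (Gamma D) -> exists t, Gamma_signing t.
Proof.
case=> c cP; exists (fun i => (-1) ^+ c i); split=> [i|u v /cP].
  by case: (c i); [right|left].
by case: (c u); case: (c v).
Qed.

Lemma psignM i j k : bipartite (Gamma D) ->
  leadsto D i j -> leadsto D j k -> psign D i k = psign D i j * psign D j k.
Proof.
move=> /bipartite_signing[t tG] ij jk.
have ik : leadsto D i k := connect_trans ij jk.
rewrite (signing_psign tG ij) (signing_psign tG jk) (signing_psign tG ik).
by rewrite (signing_mulMK _ _ _ tG).
Qed.

(** * Invertibility in terms of the intrinsic signs *)

Lemma conj_diagE (t : 'rV[int]_m) i j :
  (diag_mx t *m Binv D *m diag_mx t) i j = t 0 i * Binv D i j * t 0 j.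
Proof. by rewrite mul_mx_diag mxE mul_diag_mx mxE. Qed.

(** The only freedom in the conjugating signs is one global sign on each weak
    component: they are forced to change along the edges of [Gamma D], where
    [Binv D] is negative. *)
Lemma invertible_psign_ge0 i j :
  invertible D -> 0 <= psign D i j * Binv D i j.
Proof.
case=> t [tP /matrixP tB].
have tG : Gamma_signing (fun i => t 0 i).
  split=> // u v; rewrite edge_Gamma => /andP[uv_long uv].
  move: (tB u v); rewrite conj_diagE mxE (Binv_on_longest uv_long uv) normrN.
  have: (mult D u v)%:Z > 0 by [].
  case: (tP u) => ->; case: (tP v) => ->;
    rewrite ?mul1r ?mulr1 ?mulN1r ?mulrN1 ?opprK // => mu_gt0 e;
    by have := normr_ge0 (mult D u v)%:Z; rewrite -e oppr_ge0 leNgt mu_gt0.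
have [ij|/Binv_eq0->] := boolP (leadsto D i j); last by rewrite mulr0.
by rewrite (signing_psign tG ij) mulrAC -conj_diagE tB mxE.
Qed.

(** The signs of any 2-colouring of [Gamma D] serve as the conjugating
    diagonal. *)
Lemma psign_ge0_invertible : bipartite (Gamma D) ->
  (forall i j, 0 <= psign D i j * Binv D i j) -> invertible D.
Proof.
move=> /bipartite_signing[t tG] psB; exists (\row_i t i).
split=> [i|]; first by rewrite mxE; apply: tG.1.
apply/matrixP => i j; rewrite conj_diagE !mxE mulrAC.
have [ij|/Binv_eq0->] := boolP (leadsto D i j); last by rewrite mulr0.
move: (psB i j); rewrite (signing_psign tG ij).
by case: (tG.1 i) => ->; case: (tG.1 j) => ->;
  rewrite ?(mul1r, mulr1, mulN1r, mulrN1, opprK) => /ger0_norm; rewrite ?normrN.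
Qed.
End Inverse.

(** * Adjoining a sink *)

Section Adjoin.
Variables (k : nat) (D : digraph k) (S : {set 'I_k}).
Implicit Types a b d s : 'I_k.
Notation DS := (adjoin D S).
Notation up := (lift (@ord_max k)).

Lemma edge_adjoin_up a b : edge DS (up a) (up b) = edge D a b.
Proof. by rewrite /edge /= /adjoin_mult !liftK. Qed.

Lemma edge_adjoin_max a : edge DS (up a) ord_max = (a \in S).
Proof. by rewrite /edge /= /adjoin_mult liftK unlift_none; case: (a \in S). Qed.

Lemma edge_max_adjoin v : edge DS ord_max v = false.
Proof. by rewrite /edge /= /adjoin_mult unlift_none. Qed.

Lemma path_adjoin_up a p : path (edge DS) (up a) (map up p) = path (edge D) a p.
Proof. by elim: p a => //= b p IHp a; rewrite edge_adjoin_up IHp. Qed.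

Lemma dpath_adjoin_up a b p : dpath DS (up a) (up b) (map up p) = dpath D a b p.
Proof.
by rewrite /dpath path_adjoin_up last_map (inj_eq (@lift_inj _ ord_max)).
Qed.

Lemma path_max_adjoin p : path (edge DS) ord_max p -> p = [::].
Proof. by case: p => //= v p; rewrite edge_max_adjoin. Qed.

(** The new vertex has no outgoing edge, so no path between vertices of [D] can
    pass through it. *)
Lemma dpath_adjoin_upP a b p :
  dpath DS (up a) (up b) p -> exists2 q, p = map up q & dpath D a b q.
Proof.
move=> pab; suff [q ep]: exists q, p = map up q.
  by exists q; rewrite // -dpath_adjoin_up -ep.
case/andP: pab; elim: p a => [|v p IHp] a /=; first by exists [::].
case: (unliftP ord_max v) => [c|] -> /andP[_].
  by move=> /IHp{}IHp /IHp[q ->]; exists (c :: q).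
by move=> /path_max_adjoin-> /=; rewrite (negPf (neq_lift _ _)).
Qed.

Lemma leadsto_adjoin_up a b : leadsto DS (up a) (up b) = leadsto D a b.
Proof.
apply/idP/idP => [|] /longest_dpath[p pab _].
  by have [q _ /dpath_leadsto] := dpath_adjoin_upP pab.
by apply: (@dpath_leadsto _ _ _ _ (map up p)); rewrite dpath_adjoin_up.
Qed.

Lemma psign_adjoin_up a b : psign DS (up a) (up b) = psign D a b.
Proof.
rewrite /psign leadsto_adjoin_up; case: ifP => // ab; congr (_ ^+ _).
apply/eqP; rewrite eqn_leq; apply/andP; split.
  have [|p pab <-] := @longest_dpath _ DS (up a) (up b).
    by rewrite leadsto_adjoin_up.
  have [q -> qab] := dpath_adjoin_upP pab.
  by rewrite size_map leq_longest.
have [p pab <-] := longest_dpath ab.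
by rewrite -(size_map up) leq_longest // dpath_adjoin_up.
Qed.

Lemma leadsto_max s : s \in S -> leadsto DS (up s) ord_max.
Proof. by move=> sS; apply: connect1; rewrite edge_adjoin_max. Qed.

Lemma leadsto_max_up b : leadsto DS ord_max (up b) = false.
Proof. by apply/negP => /leadsto_leq; rewrite leqNgt lift_max ltn_ord. Qed.

Lemma psign_max_sign s :
  s \in S -> psign DS (up s) ord_max = 1 \/ psign DS (up s) ord_max = -1.
Proof.
move=> sS; rewrite /psign leadsto_max // -signr_odd.
by case: odd; [right|left].
Qed.

(** A path of length at least two from [s] to the new vertex passes through
    another element of [S]. *)
Lemma psign_only_exit s : s \in S ->
  (forall s', s' \in S -> leadsto D s s' -> s' = s) ->
  psign DS (up s) ord_max = -1.
Proof.
move=> sS only; rewrite /psign leadsto_max //.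
have [p pP <-] := longest_dpath (leadsto_max sS).
case/andP: pP; case/lastP: p => [|p v] /=; first by rewrite eq_sym (negPf (neq_lift _ _)).
rewrite last_rcons rcons_path => /andP[pP pv] /eqP ev; rewrite {v}ev in pv *.
case: (unliftP ord_max (last (up s) p)) pv => [c|] ec; rewrite ec; last first.
  by rewrite edge_max_adjoin.
rewrite edge_adjoin_max => cS.
have sc : c = s.
  apply: only => //; rewrite -leadsto_adjoin_up -ec.
  by apply/connectP; exists p.
have := path_edge_leq pP; rewrite ec sc -[leqRHS]addn0 leq_add2l leqn0.
by move=> /nilP->.
Qed.

(** Deleting the last row and column of the two triangular matrices commutes
    with inversion, as the last row of [Bmx DS] is zero off the diagonal. *)
Lemma Binv_adjoin_up a b : Binv DS (up a) (up b) = Binv D a b.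
Proof.
pose X := \matrix_(i, j) Binv DS (up i) (up j).
have XB : X *m Bmx D = 1%:M.
  apply/matrixP => i j; have /matrixP/(_ (up i) (up j)) := mulVmx (Bmx_unit DS).
  rewrite !mxE (bigD1_ord ord_max) //= mxE (negPf (neq_lift _ _)) /=.
  rewrite /adjoin_mult unlift_none mulr0 add0r (inj_eq (@lift_inj _ ord_max)) => <-.
  apply: eq_bigr => c _; rewrite !mxE (inj_eq (@lift_inj _ ord_max)).
  by rewrite /= /adjoin_mult !liftK.
have : X = Binv D by rewrite /Binv -[RHS]mul1mx -XB mulmxK ?Bmx_unit.
by move/matrixP/(_ a b); rewrite mxE.
Qed.

Lemma Binv_adjoin_max d :
  Binv DS (up d) ord_max = - \sum_(s in Sd D S d) Binv D d s.
Proof.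
have /matrixP/(_ (up d) ord_max) := mulVmx (Bmx_unit DS).
rewrite !mxE eq_sym (negPf (neq_lift _ _)) (bigD1_ord ord_max) //= mxE eqxx mulr1.
move/eqP; rewrite addr_eq0 => /eqP ->; congr (- _).
rewrite [RHS]big_mkcond; apply: eq_bigr => s _ /=.
rewrite -/(Binv DS) Binv_adjoin_up mxE eq_sym (negPf (neq_lift _ _)) /=.
rewrite /adjoin_mult liftK unlift_none !inE; case: (s \in S) => /=.
  by case: (boolP (leadsto D d s)) => [|/Binv_eq0->]; rewrite mulr1.
by rewrite mulr0.
Qed.

Lemma sum_psign d (F : 'I_k -> int) :
  \sum_(s in Sd D S d) psign DS (up s) ord_max * F s =
  \sum_(s in Sd_plus D S d) F s - \sum_(s in Sd_minus D S d) F s.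
Proof.
rewrite [in RHS]big_mkcond [X in _ - X]big_mkcond -sumrB big_mkcond.
apply: eq_bigr => s _; rewrite [s \in Sd_plus _ _ _]inE [s \in Sd_minus _ _ _]inE.
case: (boolP (s \in Sd D S d)) => [|_] /=; last by rewrite subr0.
rewrite inE => /andP[/psign_max_sign[]-> _] /=.
  by rewrite mul1r subr0.
by rewrite mulN1r sub0r.
Qed.

(** Multiplicativity gives [psign d n = psign d s * psign s n], and the factor
    [psign d s] turns [Binv D d s] into its absolute value. *)
Lemma psign_Binv_adjoin_max d : invertible D -> valid D S ->
  leadsto DS (up d) ord_max ->
  psign DS (up d) ord_max * Binv DS (up d) ord_max =
  \sum_(s in Sd_minus D S d) `|Binv D d s|
    - \sum_(s in Sd_plus D S d) `|Binv D d s|.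
Proof.
move=> hD hS dn; rewrite Binv_adjoin_max mulrN -[RHS]opprB -sum_psign mulr_sumr.
congr (- _); apply: eq_bigr => s; rewrite inE => /andP[sS ds].
have dsDS : leadsto DS (up d) (up s) by rewrite leadsto_adjoin_up.
rewrite (psignM hS dsDS (leadsto_max sS)) psign_adjoin_up.
rewrite mulrAC mulrC; congr (_ * _).
rewrite -(ger0_norm (invertible_psign_ge0 d s hD)) normrM.
by rewrite /psign ds normrX normrN1 expr1n mul1r.
Qed.

End Adjoin.

Theorem theorem4p4 (k : nat) (D : digraph k) (S : {set 'I_k})
    (hD : invertible D) (hS : valid D S) :
  invertible (adjoin D S) <->
  forall d : 'I_k, (2 <= #|Sd D S d|)%N ->
    \sum_(s in Sd_plus D S d) `|Binv D d s|
      <= \sum_(s in Sd_minus D S d) `|Binv D d s|.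
Proof.
have exits d s : s \in Sd D S d -> leadsto (adjoin D S) (lift ord_max d) ord_max.
  rewrite inE -(leadsto_adjoin_up D S) => /andP[sS ds].
  exact: (connect_trans ds (leadsto_max D sS)).
split=> [hDS d Sd2|le_pm].
  have [s sd] : exists s, s \in Sd D S d.
    by apply/set0Pn; rewrite -card_gt0; apply: ltnW.
  have := invertible_psign_ge0 (lift ord_max d) ord_max hDS.
  by rewrite (psign_Binv_adjoin_max hD hS (exits _ _ sd)) subr_ge0.
apply: (psign_ge0_invertible hS) => i j.
case: (unliftP ord_max j) => [b|] ->; case: (unliftP ord_max i) => [d|] ->.
- by rewrite psign_adjoin_up Binv_adjoin_up invertible_psign_ge0.
- by rewrite Binv_eq0 ?mulr0 // leadsto_max_up.
- have [S0|[s sd]] := set_0Vmem (Sd D S d).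
    by rewrite Binv_adjoin_max S0 big_set0 oppr0 mulr0.
  rewrite (psign_Binv_adjoin_max hD hS (exits _ _ sd)).
  have [/le_pm|] := ltnP 1 #|Sd D S d|; first by rewrite subr_ge0.
  rewrite leq_eqVlt ltnS leqn0 cards_eq0 => /orP[/cards1P[s' Sd1]|/eqP S0]; last first.
    by rewrite S0 inE in sd.
  move: sd; rewrite Sd1 => /set1P es; rewrite -{s'}es in Sd1.
  have /setIdP[sS ds] : s \in Sd D S d by rewrite Sd1 set11.
  have psN : psign (adjoin D S) (lift ord_max s) ord_max = -1.
    apply: psign_only_exit => // s' s'S ss'; apply/set1P.
    by rewrite -Sd1 inE s'S; apply: connect_trans ss'.
  by rewrite -opprB -sum_psign Sd1 big_set1 psN mulN1r opprK.
- by rewrite Binv_diag psign_refl.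
Qed.
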